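(* Let $\mathcal{A}$ be an abelian category with enough projective and injective objects, and let $\mathcal{X}$ and $\mathcal{Y}$ be classes of objects in $\mathcal{A}$ such that $\mathcal{X}^{\perp_1}={}^{\perp_1}\mathcal{Y}$. Then $(\mathcal{X},\mathcal{Y})$ is an admissible balanced pair with respect to $(\mathsf{p.l.res}^{0}(\mathcal{X}),\mathsf{p.r.res}^{0}(\mathcal{Y}))$.
   Context: Classes of objects are closed under isomorphisms. $\mathcal{X}^{\perp_i}=\{M\in\mathcal{A}:\mathrm{Ext}^i_{\mathcal{A}}(X,M)=0\ \forall X\in\mathcal{X}\}$ and $\mathcal{X}^\perp=\bigcap_{i\ge1}\mathcal{X}^{\perp_i}$; dually ${}^{\perp_i}\mathcal{Y}=\{M\in\mathcal{A}:\mathrm{Ext}^i_{\mathcal{A}}(M,Y)=0\ \forall Y\in\mathcal{Y}\}$ and ${}^\perp\mathcal{Y}=\bigcap_{i\ge1}{}^{\perp_i}\mathcal{Y}$. A left $\mathcal{X}$-resolution $\varepsilon\colon\mathcal{X}_\bullet(M)\to M$ is a (not necessarily exact) complex $\cdots\to X_1\to X_0\xrightarrow{\varepsilon}M\to0$ with all $X_k\in\mathcal{X}$, where $\mathcal{X}_\bullet(M)=(\cdots\to X_1\to X_0)$; $Z_i(\mathcal{X}_\bullet(M))=\mathrm{Ker}(X_i\to X_{i-1})$ for $i\ge1$. It is proper if it becomes exact after applying $\mathrm{Hom}_{\mathcal{A}}(X,-)$ for every $X\in\mathcal{X}$, and a proper one is admissible if $X_1\to X_0\to M\to0$ is exact.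 Dually, a right $\mathcal{Y}$-resolution of $N$ is a (not necessarily exact) complex $0\to N\to Y^0\to Y^1\to\cdots$ with all $Y^k\in\mathcal{Y}$; it is proper if it becomes exact after applying $\mathrm{Hom}_{\mathcal{A}}(-,Y)$ for every $Y\in\mathcal{Y}$, and a proper one is admissible if $0\to N\to Y^0\to Y^1$ is exact. $\mathsf{p.l.res}(\mathcal{X})$ (resp. $\mathsf{p.r.res}(\mathcal{Y})$) is the class of objects admitting a proper left $\mathcal{X}$-resolution (resp. proper right $\mathcal{Y}$-resolution). $\mathsf{p.l.res}^0(\mathcal{X})$ is the class of $M\in\mathsf{p.l.res}(\mathcal{X})$ for which there is an exact left $\mathcal{X}$-resolution $\varepsilon\colon\mathcal{X}_\bullet(M)\to M$ with $\mathrm{Ker}(\varepsilon)\in\mathcal{X}^\perp$ and $Z_i(\mathcal{X}_\bullet(M))\in\mathcal{X}^\perp$ for all $i\ge1$. Dually, $\mathsf{p.r.res}^0(\mathcal{Y})$ is the class of $N\in\mathsf{p.r.res}(\mathcal{Y})$ for which there is an exact right $\mathcal{Y}$-resolution $0\to N\to Y^0\to Y^1\to\cdots$ with $\mathrm{CoKer}(N\to Y^0)\in{}^\perp\mathcal{Y}$ and $\mathrm{CoKer}(Y^{i-1}\to Y^i)\in{}^\perp\mathcal{Y}$ for all $i\ge1$. A complex is $\mathrm{Hom}_{\mathcal{A}}(\mathcal{X},-)$-acyclic (resp. $\mathrm{Hom}_{\mathcal{A}}(-,\mathcal{Y})$-acyclic) if it becomes exact after applying $\mathrm{Hom}_{\mathcal{A}}(X,-)$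 for every $X\in\mathcal{X}$ (resp. $\mathrm{Hom}_{\mathcal{A}}(-,Y)$ for every $Y\in\mathcal{Y}$). $(\mathcal{X},\mathcal{Y})$ is an admissible balanced pair with respect to $(\tilde{\mathcal{X}},\tilde{\mathcal{Y}})$ if: $\mathcal{X}\subseteq\tilde{\mathcal{X}}\subseteq\mathsf{p.l.res}(\mathcal{X})$ and $\mathcal{Y}\subseteq\tilde{\mathcal{Y}}\subseteq\mathsf{p.r.res}(\mathcal{Y})$; every $M\in\tilde{\mathcal{X}}$ has an admissible $\mathrm{Hom}_{\mathcal{A}}(-,\mathcal{Y})$-acyclic proper left $\mathcal{X}$-resolution; every $N\in\tilde{\mathcal{Y}}$ has an admissible $\mathrm{Hom}_{\mathcal{A}}(\mathcal{X},-)$-acyclic proper right $\mathcal{Y}$-resolution.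
   Formalization: The classes X and Y are additionally assumed to contain the zero objects; otherwise the claim fails, e.g. for X = Y = the modules isomorphic to Z/2 over Z/4, where Z/2 lies in X but not in p.l.res^0(X). *)

(* Defs.v *)
From mathcomp Require Import all_boot all_algebra.

Set Implicit Arguments.
Unset Strict Implicit.
Unset Printing Implicit Defensive.

Import GRing.Theory.
Local Open Scope ring_scope.

Record preaddCat := PreaddCat {
  obj :> Type;
  hom : obj -> obj -> zmodType;
  idm : forall A : obj, hom A A;
  comp : forall A B C : obj, hom B C -> hom A B -> hom A C;
  compA : forall (A B C D : obj) (h : hom C D) (g : hom B C) (f : hom A B),
    comp h (comp g f) = comp (comp h g) f;
  comp1m : forall (A B : obj) (f : hom A B), comp (idm B) f = f;
  compm1 : forall (A B : obj) (f : hom A B), comp f (idm A) = f;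
  compDl : forall (A B C : obj) (g h : hom B C) (f : hom A B),
    comp (g + h) f = comp g f + comp h f;
  compDr : forall (A B C : obj) (g : hom B C) (f h : hom A B),
    comp g (f + h) = comp g f + comp g h
}.
Arguments hom {p} A B.
Arguments idm {p} A.
Arguments comp {p A B C} g f.

Notation "g \oc f" := (comp g f)
  (at level 40, left associativity, format "g  \oc  f").

Section AbelianCategories.
Variable A : preaddCat.

Definition isomorphic (M N : A) : Prop :=
  exists (f : hom M N) (g : hom N M), g \oc f = idm M /\ f \oc g = idm N.

Definition mono (M N : A) (f : hom M N) : Prop :=
  forall (T : A) (u v : hom T M), f \oc u = f \oc v -> u = v.

Definition epi (M N : A) (f : hom M N) : Prop :=
  forall (T : A) (u v : hom N T), u \oc f = v \oc f -> u = v.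

(* Initial and terminal; the existence of the arrows is given by 0. *)
Definition zero_object (Z : A) : Prop :=
  (forall (M : A) (f g : hom Z M), f = g) /\
  (forall (M : A) (f g : hom M Z), f = g).

Definition is_kernel (M N : A) (f : hom M N) (K : A) (k : hom K M) : Prop :=
  f \oc k = 0 /\
  forall (T : A) (t : hom T M), f \oc t = 0 -> exists! u : hom T K, k \oc u = t.

Definition is_cokernel (M N : A) (f : hom M N) (Q : A) (q : hom N Q) : Prop :=
  q \oc f = 0 /\
  forall (T : A) (t : hom N T), t \oc f = 0 -> exists! u : hom Q T, u \oc q = t.

Definition is_biproduct (M N S : A) (i1 : hom M S) (i2 : hom N S)
    (p1 : hom S M) (p2 : hom S N) : Prop :=
  [/\ p1 \oc i1 = idm M, p2 \oc i2 = idm N, p1 \oc i2 = 0, p2 \oc i1 = 0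
    & i1 \oc p1 + i2 \oc p2 = idm S].

Record abelian : Prop := Abelian {
  ab_zero : exists Z : A, zero_object Z;
  ab_biproduct : forall M N : A,
    exists (S : A) (i1 : hom M S) (i2 : hom N S) (p1 : hom S M) (p2 : hom S N),
      is_biproduct i1 i2 p1 p2;
  ab_kernel : forall (M N : A) (f : hom M N),
    exists (K : A) (k : hom K M), is_kernel f k;
  ab_cokernel : forall (M N : A) (f : hom M N),
    exists (Q : A) (q : hom N Q), is_cokernel f q;
  ab_mono_normal : forall (M N : A) (f : hom M N), mono f ->
    exists (Q : A) (q : hom N Q), is_kernel q f;
  ab_epi_normal : forall (M N : A) (f : hom M N), epi f ->
    exists (K : A) (k : hom K M), is_cokernel k f
}.

Definition projective (P : A) : Prop :=
  forall (M N : A) (e : hom M N), epi e ->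
  forall f : hom P N, exists g : hom P M, e \oc g = f.

Definition injective_obj (I : A) : Prop :=
  forall (M N : A) (m : hom M N), mono m ->
  forall f : hom M I, exists g : hom N I, g \oc m = f.

Definition enough_projectives : Prop :=
  forall M : A, exists (P : A) (e : hom P M), projective P /\ epi e.

Definition enough_injectives : Prop :=
  forall M : A, exists (I : A) (m : hom M I), injective_obj I /\ mono m.

Definition is_image (M N : A) (f : hom M N) (I : A) (m : hom I N) : Prop :=
  exists (Q : A) (q : hom N Q), is_cokernel f q /\ is_kernel q m.

(* Im f = Ker g as subobjects of N. *)
Definition exact (M N P : A) (f : hom M N) (g : hom N P) : Prop :=
  exists (K : A) (k : hom K N), is_image f k /\ is_kernel g k.

(* Augmented complexes  ... -> X_1 -> X_0 -> M -> 0, not necessarily exact,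
   with ld n : X_(n+1) -> X_n. *)
Record left_complex (M : A) := LeftComplex {
  lobj : nat -> A;
  laug : hom (lobj 0) M;
  ld : forall n, hom (lobj n.+1) (lobj n);
  laug_ld : laug \oc ld 0 = 0;
  ld_ld : forall n, ld n \oc ld n.+1 = 0
}.

(* Coaugmented complexes  0 -> N -> Y^0 -> Y^1 -> ..., not necessarily exact,
   with rd n : Y^n -> Y^(n+1). *)
Record right_complex (N : A) := RightComplex {
  robj : nat -> A;
  raug : hom N (robj 0);
  rd : forall n, hom (robj n) (robj n.+1);
  rd_raug : rd 0 \oc raug = 0;
  rd_rd : forall n, rd n.+1 \oc rd n = 0
}.

(* Exactness at M, respectively N, is exactness of X_0 -> M -> 0,
   respectively 0 -> N -> Y^0. *)
Definition exact_left (M : A) (R : left_complex M) : Prop :=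
  [/\ epi (laug R), exact (ld R 0) (laug R)
    & forall n, exact (ld R n.+1) (ld R n)].

Definition exact_right (N : A) (R : right_complex N) : Prop :=
  [/\ mono (raug R), exact (raug R) (rd R 0)
    & forall n, exact (rd R n) (rd R n.+1)].

(* Hom(U, f) and Hom(f, V) *)
Definition hom_post (U M N : A) (f : hom M N) : hom U M -> hom U N :=
  fun u => f \oc u.

Definition hom_pre (V M N : A) (f : hom M N) : hom N V -> hom M V :=
  fun u => u \oc f.

Definition ab_exact (G H K : zmodType) (f : G -> H) (g : H -> K) : Prop :=
  forall h : H, g h = 0 <-> exists x : G, f x = h.

Definition ab_surjective (G H : zmodType) (f : G -> H) : Prop :=
  forall h : H, exists x : G, f x = h.

(* The four ways of applying Hom to a whole augmented complex:
   - ... -> Hom(U,X_1) -> Hom(U,X_0) -> Hom(U,M) -> 0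
   - 0 -> Hom(M,V) -> Hom(X_0,V) -> Hom(X_1,V) -> ...
   - 0 -> Hom(U,N) -> Hom(U,Y^0) -> Hom(U,Y^1) -> ...
   - ... -> Hom(Y^1,V) -> Hom(Y^0,V) -> Hom(N,V) -> 0 *)
Definition left_post_exact (U M : A) (R : left_complex M) : Prop :=
  [/\ ab_surjective (@hom_post U _ _ (laug R)),
      ab_exact (@hom_post U _ _ (ld R 0)) (@hom_post U _ _ (laug R))
    & forall n,
      ab_exact (@hom_post U _ _ (ld R n.+1)) (@hom_post U _ _ (ld R n))].

Definition left_pre_exact (V M : A) (R : left_complex M) : Prop :=
  [/\ injective (@hom_pre V _ _ (laug R)),
      ab_exact (@hom_pre V _ _ (laug R)) (@hom_pre V _ _ (ld R 0))
    & forall n,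
      ab_exact (@hom_pre V _ _ (ld R n)) (@hom_pre V _ _ (ld R n.+1))].

Definition right_post_exact (U N : A) (R : right_complex N) : Prop :=
  [/\ injective (@hom_post U _ _ (raug R)),
      ab_exact (@hom_post U _ _ (raug R)) (@hom_post U _ _ (rd R 0))
    & forall n,
      ab_exact (@hom_post U _ _ (rd R n)) (@hom_post U _ _ (rd R n.+1))].

Definition right_pre_exact (V N : A) (R : right_complex N) : Prop :=
  [/\ ab_surjective (@hom_pre V _ _ (raug R)),
      ab_exact (@hom_pre V _ _ (rd R 0)) (@hom_pre V _ _ (raug R))
    & forall n,
      ab_exact (@hom_pre V _ _ (rd R n.+1)) (@hom_pre V _ _ (rd R n))].

Definition projective_resolution (M : A) (P : left_complex M) : Prop :=
  (forall n, projective (lobj P n)) /\ exact_left P.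

(* Ext^i(M, N) = 0, where Ext^i(M, N) is the i-th cohomology of Hom(P, N) for
   a projective resolution P of M (augmentation omitted).  The group does not
   depend on P up to isomorphism, hence the quantification over every P; when
   there are enough projectives, every M has such a P. *)
Definition Ext_zero (i : nat) (M N : A) : Prop :=
  forall P : left_complex M, projective_resolution P ->
  match i with
  | 0 => injective (@hom_pre N _ _ (ld P 0))
  | j.+1 => ab_exact (@hom_pre N _ _ (ld P j)) (@hom_pre N _ _ (ld P j.+1))
  end.

End AbelianCategories.

Section Classes.
Variable A : preaddCat.
Implicit Types X Y : A -> Prop.

Definition iso_closed X : Prop :=
  forall M N : A, isomorphic M N -> X M -> X N.

Definition contains_zero X : Prop := forall Z : A, zero_object Z -> X Z.

Definition rperp_at X (i : nat) : A -> Prop :=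
  fun M => forall U : A, X U -> Ext_zero i U M.

Definition rperp X : A -> Prop :=
  fun M => forall i : nat, (1 <= i)%N -> rperp_at X i M.

Definition lperp_at Y (i : nat) : A -> Prop :=
  fun M => forall V : A, Y V -> Ext_zero i M V.

Definition lperp Y : A -> Prop :=
  fun M => forall i : nat, (1 <= i)%N -> lperp_at Y i M.

Definition left_resolution X (M : A) (R : left_complex M) : Prop :=
  forall n, X (lobj R n).

Definition right_resolution Y (N : A) (R : right_complex N) : Prop :=
  forall n, Y (robj R n).

Definition left_post_acyclic X (M : A) (R : left_complex M) : Prop :=
  forall U : A, X U -> left_post_exact U R.

Definition left_pre_acyclic Y (M : A) (R : left_complex M) : Prop :=
  forall V : A, Y V -> left_pre_exact V R.

Definition right_post_acyclic X (N : A) (R : right_complex N) : Prop :=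
  forall U : A, X U -> right_post_exact U R.

Definition right_pre_acyclic Y (N : A) (R : right_complex N) : Prop :=
  forall V : A, Y V -> right_pre_exact V R.

Definition proper_left X (M : A) (R : left_complex M) : Prop :=
  left_resolution X R /\ left_post_acyclic X R.

Definition proper_right Y (N : A) (R : right_complex N) : Prop :=
  right_resolution Y R /\ right_pre_acyclic Y R.

Definition admissible_left X (M : A) (R : left_complex M) : Prop :=
  [/\ proper_left X R, epi (laug R) & exact (ld R 0) (laug R)].

Definition admissible_right Y (N : A) (R : right_complex N) : Prop :=
  [/\ proper_right Y R, mono (raug R) & exact (raug R) (rd R 0)].

Definition plres X : A -> Prop :=
  fun M => exists R : left_complex M, proper_left X R.

Definition prres Y : A -> Prop :=
  fun N => exists R : right_complex N, proper_right Y R.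

Definition ker_in X (M N : A) (f : hom M N) : Prop :=
  exists (K : A) (k : hom K M), is_kernel f k /\ X K.

Definition coker_in Y (M N : A) (f : hom M N) : Prop :=
  exists (Q : A) (q : hom N Q), is_cokernel f q /\ Y Q.

(* ld R n has kernel Z_(n+1) and rd R n = (Y^n -> Y^(n+1)), so the indices
   i >= 1 of cycles and cokernels correspond to all n. *)
Definition plres0 X : A -> Prop :=
  fun M => plres X M /\
  exists R : left_complex M,
    [/\ left_resolution X R, exact_left R, ker_in (rperp X) (laug R)
      & forall n, ker_in (rperp X) (ld R n)].

Definition prres0 Y : A -> Prop :=
  fun N => prres Y N /\
  exists R : right_complex N,
    [/\ right_resolution Y R, exact_right R, coker_in (lperp Y) (raug R)
      & forall n, coker_in (lperp Y) (rd R n)].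

Record admissible_balanced_pair X Y X' Y' : Prop := AdmissibleBalancedPair {
  abp_subX : forall M : A, X M -> X' M;
  abp_plres : forall M : A, X' M -> plres X M;
  abp_subY : forall N : A, Y N -> Y' N;
  abp_prres : forall N : A, Y' N -> prres Y N;
  abp_left : forall M : A, X' M ->
    exists R : left_complex M, admissible_left X R /\ left_pre_acyclic Y R;
  abp_right : forall N : A, Y' N ->
    exists R : right_complex N, admissible_right Y R /\ right_post_acyclic X R
}.

End Classes.

(* Main.v *)
From mathcomp Require Import all_boot all_algebra.
From Stdlib Require Import IndefiniteDescription.
Require Import Defs.

(** The point is that if [K] lies in X^⊥ and [V] in Y, then every map [K -> V]
extends along every monomorphism out of [K].  Embed [K] into an injective
object [I] with cokernel [C]: then Ext^1(U, C) = Ext^2(U, K) = 0 for [U] in X,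
so [C] lies in X^⊥1 = ^⊥1 Y, the map extends to [I], and [I] is injective.
Hence an exact X-resolution with kernels in X^⊥ stays exact under Hom(-, V),
while it stays exact under Hom(U, -) because Ext^1(U, -) kills its kernels.
The statement about Y follows in the same way, by exactness arguments in the
opposite category and the dimension shift Ext^1(K, V) = Ext^2(C, V) for the
syzygy [K] of [C]. *)

Set Implicit Arguments.
Unset Strict Implicit.
Unset Printing Implicit Defensive.

Import GRing.Theory.
Local Open Scope ring_scope.

(** * Kernels, cokernels and exactness in a preadditive category *)

Section Preadditive.
Variable A : preaddCat.
Implicit Types M N K Q T : A.

Lemma comp0m M N T (f : hom M N) : (0 : hom N T) \oc f = 0.
Proof. by apply: (@addrI _ ((0 : hom N T) \oc f)); rewrite -compDl !addr0. Qed.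

Lemma compm0 M N T (f : hom N T) : f \oc (0 : hom M N) = 0.
Proof. by apply: (@addrI _ (f \oc (0 : hom M N))); rewrite -compDr !addr0. Qed.

Lemma compNl M N T (g : hom N T) (f : hom M N) : (- g) \oc f = - (g \oc f).
Proof. by apply/eqP; rewrite -addr_eq0 -compDl addNr comp0m. Qed.

Lemma compNr M N T (g : hom N T) (f : hom M N) : g \oc (- f) = - (g \oc f).
Proof. by apply/eqP; rewrite -addr_eq0 -compDr addNr compm0. Qed.

Lemma compBl M N T (g h : hom N T) (f : hom M N) :
  (g - h) \oc f = g \oc f - h \oc f.
Proof. by rewrite compDl compNl. Qed.

Lemma compBr M N T (g : hom N T) (f h : hom M N) :
  g \oc (f - h) = g \oc f - g \oc h.
Proof. by rewrite compDr compNr. Qed.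

Lemma mono0P M N (f : hom M N) :
  (forall T (t : hom T M), f \oc t = 0 -> t = 0) <-> mono f.
Proof.
split=> [f0 T u v fuv | fmono T t ft0].
  by apply/subr0_eq/f0; rewrite compBr fuv subrr.
by apply: fmono; rewrite compm0.
Qed.

Lemma epi0P M N (f : hom M N) :
  (forall T (t : hom N T), t \oc f = 0 -> t = 0) <-> epi f.
Proof.
split=> [f0 T u v fuv | fepi T t ft0].
  by apply/subr0_eq/f0; rewrite compBl fuv subrr.
by apply: fepi; rewrite comp0m.
Qed.

Lemma mono_comp M N T (g : hom N T) (f : hom M N) :
  mono g -> mono f -> mono (g \oc f).
Proof. by move=> gm fm S u v; rewrite -!compA => /gm/fm. Qed.

Lemma mono_idm M : mono (idm M).
Proof. by move=> T u v; rewrite !comp1m. Qed.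

Lemma epi_idm M : epi (idm M).
Proof. by move=> T u v; rewrite !compm1. Qed.

Lemma kernelP M N (f : hom M N) K (k : hom K M) :
  is_kernel f k <->
  [/\ f \oc k = 0, mono k
    & forall T (t : hom T M), f \oc t = 0 -> exists u, k \oc u = t].
Proof.
split=> [[fk0 fac] | [fk0 kmono fac]]; split=> //.
- move=> T u v kuv.
  have [|w [_ wuniq]] := fac T (k \oc v); first by rewrite compA fk0 comp0m.
  by rewrite -(wuniq u kuv); exact: wuniq.
- by move=> T t /fac[u [ku _]]; exists u.
- move=> T t /fac[u ku]; exists u; split=> // v kv.
  by apply: kmono; rewrite ku kv.
Qed.

Lemma cokernelP M N (f : hom M N) Q (q : hom N Q) :
  is_cokernel f q <->
  [/\ q \oc f = 0, epi q
    & forall T (t : hom N T), t \oc f = 0 -> exists u, u \oc q = t].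
Proof.
split=> [[qf0 fac] | [qf0 qepi fac]]; split=> //.
- move=> T u v uvq.
  have [|w [_ wuniq]] := fac T (v \oc q); first by rewrite -compA qf0 compm0.
  by rewrite -(wuniq u uvq); exact: wuniq.
- by move=> T t /fac[u [uq _]]; exists u.
- move=> T t /fac[u uq]; exists u; split=> // v vq.
  by apply: qepi; rewrite uq vq.
Qed.

Lemma eq_kernel M N N' (f : hom M N) (f' : hom M N') K (k : hom K M) :
  (forall T (t : hom T M), f \oc t = 0 <-> f' \oc t = 0) ->
  is_kernel f k -> is_kernel f' k.
Proof.
move=> ff' /kernelP[fk0 kmono fac]; apply/kernelP; split=> //; first exact/ff'.
by move=> T t /ff'/fac.
Qed.

Lemma kernel_mono_comp M N N' (f : hom M N) (j : hom N N') K (k : hom K M) :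
  mono j -> is_kernel (j \oc f) k <-> is_kernel f k.
Proof.
move=> /mono0P jm; have E T (t : hom T M) : j \oc f \oc t = 0 <-> f \oc t = 0.
  by rewrite -compA; split=> [/jm | ->]; rewrite ?compm0.
by split; apply: eq_kernel => T t; split=> /E.
Qed.

Lemma cokernel_epi_comp M M' N (f : hom M N) (p : hom M' M) Q (q : hom N Q) :
  epi p -> is_cokernel f q -> is_cokernel (f \oc p) q.
Proof.
move=> pe /cokernelP[qf0 qe fac]; apply/cokernelP; split=> //.
  by rewrite compA qf0 comp0m.
by move=> T t; rewrite compA => /(proj2 (epi0P p) pe)/fac.
Qed.

Lemma exact_comp0 M N T (f : hom M N) (g : hom N T) : exact f g -> g \oc f = 0.
Proof.
move=> [K [k [[Q [q [/cokernelP[qf0 _ _] /kernelP[_ _ fac]]]] /kernelP[gk0 _ _]]]].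
by have [u <-] := fac _ _ qf0; rewrite compA gk0 comp0m.
Qed.

Lemma exact_mono_comp M N T T' (f : hom M N) (g : hom N T) (j : hom T T') :
  mono j -> exact f g -> exact f (j \oc g).
Proof.
move=> jm [K [k [im_f kg]]]; exists K, k; split=> //.
exact/kernel_mono_comp.
Qed.

(** * Complexes concentrated in degree zero *)

Section ZeroObject.
Variables (Z : A) (Z0 : zero_object Z).

Lemma zero_object_kernel M (f : hom Z M) : is_kernel f (idm Z).
Proof.
apply/kernelP; split=> [||T t _]; last by exists t; exact: Z0.2.
  by exact: Z0.1.
exact: mono_idm.
Qed.

Lemma zero_kernel_mono M N (f : hom M N) :
  mono f -> is_kernel f (0 : hom Z M).
Proof.
move=> /mono0P fm; apply/kernelP; split=> [||T t /fm->].
- exact: compm0.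
- by move=> T u v _; exact: Z0.2.
- by exists 0; exact: compm0.
Qed.

Lemma zero_cokernel M (f : hom Z M) : is_cokernel f (idm M).
Proof.
apply/cokernelP; split=> [||T t _]; last by exists t; exact: compm1.
  exact: Z0.1.
exact: epi_idm.
Qed.

Lemma exact_zero_mono M N (f : hom Z M) (g : hom M N) : mono g -> exact f g.
Proof.
move=> gm; exists Z, 0; split; last exact: zero_kernel_mono.
exists M, (idm M); split; first exact: zero_cokernel.
exact/zero_kernel_mono/mono_idm.
Qed.

Lemma exact_zero_object M N (f : hom M Z) (g : hom Z N) : exact f g.
Proof.
exists Z, (idm Z); split; last exact: zero_object_kernel.
exists Z, (idm Z); split; last exact: zero_object_kernel.
apply/cokernelP; split=> [||T t _]; first exact: Z0.2.
  exact: epi_idm.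
by exists t; exact: compm1.
Qed.

Lemma Ext_zero_zero (U : A) i : (1 <= i)%N -> Ext_zero i U Z.
Proof.
case: i => // i _ P _ h; split=> _; first by exists 0; exact: Z0.2.
exact: Z0.2.
Qed.

(** The identity augmentation makes every kernel a zero object, so this complex puts [M] in
    [plres0 X] once [M] and the zero objects lie in [X]. *)
Definition trivial_left_complex M : left_complex M.
Proof.
refine (@LeftComplex A M (fun n => if n is _.+1 then Z else M) (idm M)
  (fun _ => 0) _ _) => *; exact: compm0.
Defined.

Lemma exact_trivial_left_complex M : exact_left (trivial_left_complex M).
Proof.
split=> [||n]; first exact: epi_idm.
  exact/exact_zero_mono/mono_idm.
exact: exact_zero_object.
Qed.

Lemma trivial_left_complex_ker_in (W : A -> Prop) M : W Z ->
  ker_in W (laug (trivial_left_complex M)) /\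
  forall n, ker_in W (ld (trivial_left_complex M) n).
Proof.
move=> WZ; split=> [|n]; exists Z.
  by exists 0; split; [exact/zero_kernel_mono/mono_idm | ].
by exists (idm Z); split; first exact: zero_object_kernel.
Qed.

End ZeroObject.
End Preadditive.

(** Objects and hom groups are reused unwrapped and the definition is transparent, so kernels and
    monos of [opcat A] are, up to conversion, cokernels and epis of [A]. *)
Definition opcat (A : preaddCat) : preaddCat.
Proof.
refine (@PreaddCat A (fun M N => hom N M) (@idm A) (fun _ _ _ g f => f \oc g)
  _ _ _ _ _) => *.
- by rewrite compA.
- exact: compm1.
- exact: comp1m.
- exact: compDr.
- exact: compDl.
Defined.

(** * Images, exactness and duality in an abelian category *)

Section Abelian.
Variables (A : preaddCat) (abA : abelian A).
Implicit Types M N K Q T : A.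

(** The epi [e] is the cokernel of some [l], and [l] factors through [k]; hence a map that kills [k]
    kills [l]. *)
Lemma epi_cokernel M N K (e : hom M N) (k : hom K M) :
  epi e -> is_kernel e k -> is_cokernel k e.
Proof.
move=> ee /kernelP[ek0 _ efac]; apply/cokernelP; split=> // T t tk0.
have [L [l /cokernelP[el0 _ lfac]]] := ab_epi_normal abA ee.
by have [u lE] := efac _ _ el0; apply: lfac; rewrite -lE compA tk0 comp0m.
Qed.

Lemma mono_kernel M N Q (m : hom M N) (q : hom N Q) :
  mono m -> is_cokernel m q -> is_kernel q m.
Proof.
move=> mm /cokernelP[qm0 _ qfac]; apply/kernelP; split=> // T t qt0.
have [L [l /kernelP[lm0 _ lfac]]] := ab_mono_normal abA mm.
by have [u lE] := qfac _ _ lm0; apply: lfac; rewrite -lE -compA qt0 compm0.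
Qed.

(** If [u] kills [p], then [p] factors through the kernel [j] of [u]. The mono [k \oc j] is the
    kernel of some [r]; as [r] kills [k \oc p], it factors through [q] and so kills [k]. Thus [k]
    factors through [k \oc j], which makes [j] a split epi and [u] zero. *)
Lemma image_epi M N K Q (p : hom M K) (k : hom K N) (q : hom N Q) :
  is_cokernel (k \oc p) q -> is_kernel q k -> epi p.
Proof.
move=> /cokernelP[_ _ qfac] /kernelP[qk0 km _]; apply/epi0P => T u up0.
have [J [j /kernelP[uj0 jm jfac]]] := ab_kernel abA u.
have [p' pE] := jfac _ _ up0.
have [R [r /kernelP[rkj0 _ rfac]]] := ab_mono_normal abA (mono_comp km jm).
have [|r' rE] := qfac _ r; first by rewrite -pE !compA -(compA r) rkj0 comp0m.
have [|w kE] := rfac _ k; first by rewrite -rE -compA qk0 compm0.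
have jw1 : j \oc w = idm K by apply: km; rewrite compA kE compm1.
by rewrite -(compm1 u) -jw1 compA uj0 comp0m.
Qed.

Lemma mono_epi_factor M N (f : hom M N) :
  exists K (k : hom K N) (p : hom M K), [/\ mono k, epi p & k \oc p = f].
Proof.
have [Q [q cq]] := ab_cokernel abA f; have [K [k kk]] := ab_kernel abA q.
have /kernelP[_ km kfac] := kk; have /cokernelP[qf0 _ _] := cq.
have [p pE] := kfac _ _ qf0; exists K, k, p; split=> //.
by apply: (image_epi _ kk); rewrite pE.
Qed.

(** The working form of exactness. The kernel supplied by [exact] shows that [g] and the cokernel
    [q] of [f] annihilate the same maps, so any kernel of [g] is a kernel of [q] and [image_epi]
    applies. *)
Lemma exact_kernel_factor M N T K (f : hom M N) (g : hom N T) (k : hom K N) :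
  exact f g -> is_kernel g k -> exists2 p : hom M K, epi p & k \oc p = f.
Proof.
move=> fg kg; have /kernelP[_ _ kfac] := kg.
have [p pE] := kfac _ _ (exact_comp0 fg); exists p => //.
have [K' [k' [[Q [q [cq kq]]] kg']]] := fg.
apply: (@image_epi _ _ _ _ p k q); first by rewrite pE.
apply: eq_kernel kg => S t.
have /kernelP[gk0 _ gfac] := kg'; have /kernelP[qk0 _ qfac] := kq.
by split=> [/gfac | /qfac] [u <-]; rewrite compA ?gk0 ?qk0 comp0m.
Qed.

(** A kernel of [m \oc p] is also one of [p], and [f] is that kernel after an epi. Taking [m] to be
    an identity covers the end of a resolution. *)
Lemma exact_cokernel M N T Q (f : hom M N) (p : hom N Q) (m : hom Q T) :
  exact f (m \oc p) -> mono m -> epi p -> is_cokernel f p.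
Proof.
move=> fg mm pe; have [K [k kg]] := ab_kernel abA (m \oc p).
have [r re <-] := exact_kernel_factor fg kg.
apply: cokernel_epi_comp => //; apply: epi_cokernel => //.
exact: (iffLR (kernel_mono_comp p k mm) kg).
Qed.

Lemma exact_splice M N K T (p : hom M K) (k : hom K N) (e : hom N T) :
  epi p -> epi e -> is_kernel e k -> exact (k \oc p) e.
Proof.
move=> pe ee ke; exists K, k; split=> //; exists T, e; split=> //.
exact/cokernel_epi_comp/epi_cokernel.
Qed.

(** The two sides differ only in whether [k] is the kernel of [q] or [q] the cokernel of [k]; for a
    mono [k] and an epi [q] these agree. *)
Lemma exact_op M N T (f : hom M N) (g : hom N T) :
  exact f g <-> @exact (opcat A) T N M g f.
Proof.
split=> [[K [k [[Q [q [cq kq]]] kg]]] | [Q [q [[K [k [kg cq]]] cf]]]].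
  exists Q, q; split=> //; exists K, k; split=> //.
  by have /cokernelP[_ qe _] := cq; exact: (epi_cokernel qe kq).
exists K, k; split=> //; exists Q, q; split=> //.
by have /kernelP[_ km _] : is_kernel g k := kg; exact: (mono_kernel km cq).
Qed.

Lemma abelian_op : abelian (opcat A).
Proof.
split.
- by have [Z [Z1 Z2]] := ab_zero abA; exists Z.
- move=> M N; have [S [i1 [i2 [p1 [p2 [? ? ? ? ?]]]]]] := ab_biproduct abA M N.
  by exists S, p1, p2, i1, i2; split.
- by move=> M N f; exact: (ab_cokernel abA f).
- by move=> M N f; exact: (ab_kernel abA f).
- by move=> M N f fm; exact: (ab_epi_normal abA fm).
- by move=> M N f fe; exact: (ab_mono_normal abA fe).
Qed.

(* A consequence of Ext^1(U, K) = 0 phrased without projectives; read in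
   [opcat A], it is a consequence of Ext^1(K, U) = 0. *)
Definition lifts_with_kernel U K : Prop :=
  forall B C (k : hom K B) (e : hom B C), epi e -> is_kernel e k ->
  forall h : hom U C, exists g : hom U B, e \oc g = h.

(** Read in [opcat A], this says that maps from [V] to [K] lift along every epimorphism onto [K]. *)
Definition extends_along_monos V K : Prop :=
  forall B (m : hom K B), mono m ->
  forall f : hom K V, exists g : hom B V, g \oc m = f.

(** * Exactness after applying Hom *)

(** A map killed by [g] factors through the kernel of [g], onto which [f] induces an epi [p] with
    the same kernel as [f]; the hypothesis then lifts it along [p]. *)
Lemma post_exact U M N T (f : hom M N) (g : hom N T) :
  exact f g -> ker_in (lifts_with_kernel U) f ->
  ab_exact (@hom_post _ U _ _ f) (@hom_post _ U _ _ g).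
Proof.
move=> fg [L [l [kf liftL]]] h; rewrite /hom_post.
split=> [gh0 | [x <-]]; last first.
  by rewrite compA (exact_comp0 fg) comp0m.
have [K [k kg]] := ab_kernel abA g; have [p pe pE] := exact_kernel_factor fg kg.
have /kernelP[_ km kfac] := kg; have [v <-] := kfac _ _ gh0.
have kp : is_kernel p l by apply: (iffLR (kernel_mono_comp p l km)); rewrite pE.
by have [x <-] := liftL _ _ _ _ pe kp v; exists x; rewrite compA pE.
Qed.

Lemma left_post_exactI U M (R : left_complex M) :
  exact_left R -> ker_in (lifts_with_kernel U) (laug R) ->
  (forall n, ker_in (lifts_with_kernel U) (ld R n)) -> left_post_exact U R.
Proof.
move=> [augE ex0 exS] [K [k [kaug liftK]]] kd.
split=> [h||n]; [exact: liftK kaug h | exact: post_exact | exact: post_exact].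
Qed.

(** Write [g] as an epi [p] followed by the kernel [l] of [h]. Then [p] is a cokernel of [f], so [t]
    descends along [p], and the result extends along the mono [l]. *)
Lemma pre_exact V M N T S (f : hom M N) (g : hom N T) (h : hom T S) :
  exact f g -> exact g h -> ker_in (extends_along_monos V) h ->
  ab_exact (@hom_pre _ V _ _ g) (@hom_pre _ V _ _ f).
Proof.
move=> fg gh [L [l [kh extL]]] t; rewrite /hom_pre.
split=> [tf0 | [x <-]]; last first.
  by rewrite -compA (exact_comp0 fg) compm0.
have [p pe pE] := exact_kernel_factor gh kh; have /kernelP[_ lm _] := kh.
rewrite -pE in fg; have /cokernelP[_ _ pfac] := exact_cokernel fg lm pe.
have [w <-] := pfac _ _ tf0; have [x <-] := extL _ _ lm w.
by exists x; rewrite -pE compA.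
Qed.

Lemma left_pre_exactI V M (R : left_complex M) :
  exact_left R -> ker_in (extends_along_monos V) (laug R) ->
  (forall n, ker_in (extends_along_monos V) (ld R n)) -> left_pre_exact V R.
Proof.
move=> [augE ex0 exS] kaug kd; split=> [u v||n]; first exact: augE.
- move=> t; rewrite /hom_pre; split=> [td0 | [x <-]]; last first.
    by rewrite -compA laug_ld compm0.
  rewrite -[laug R]comp1m in ex0.
  have /cokernelP[_ _ fac] := exact_cokernel ex0 (@mono_idm _ _) augE.
  exact: fac.
(* Exactness at [lobj R n.+1] uses the kernel of the map leaving [lobj R n], which for [n = 0] is
   the augmentation. *)
- by case: n => [|n]; [apply: pre_exact kaug | apply: pre_exact (kd n)].
Qed.


(** * Consequences of vanishing Ext^1, and dimension shifting *)

(** Lift [h \oc laug P] to [g : P_0 -> B]. Its restriction along [ld P 0] lands in [K] as a cocycle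
    [t], which bounds some [s]; then [g - k \oc s] kills [ld P 0] and descends to [U]. *)
Lemma Ext1_lifts U K (P : left_complex U) :
  projective_resolution P -> Ext_zero 1 U K -> lifts_with_kernel U K.
Proof.
move=> resP /(_ P resP) extU B C k e ee ke h.
have [projP [augE ex0 ex1]] := resP; have /kernelP[ek0 km kfac] := ke.
have [g gE] := projP 0 _ _ _ ee (h \oc laug P).
have [|t tE] := kfac _ (g \oc ld P 0).
  by rewrite compA gE -compA laug_ld compm0.
have [|s sE] := (extU t).1.
  by apply: km; rewrite /hom_pre compm0 compA tE -compA ld_ld compm0.
rewrite -[laug P]comp1m in ex0.
have /cokernelP[_ _ afac] := exact_cokernel ex0 (@mono_idm _ _) augE.
have [|h' h'E] := afac _ (g - k \oc s).
  by rewrite compBl -compA [s \oc _]sE tE subrr.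
exists h'; apply: augE; rewrite -compA h'E compBr compA ek0 comp0m subr0.
exact: gE.
Qed.

(* The cocycle [f t p : P_1 -> V] of the pushed-out extension bounds some
   [s : P_0 -> V], and [(f, s)] on [K + P_0] descends to the quotient [B]. *)
Lemma Ext1_extends C V (P : left_complex C) :
  projective_resolution P -> Ext_zero 1 C V ->
  forall K B (m : hom K B) (e : hom B C), epi e -> is_kernel e m ->
  forall f : hom K V, exists g : hom B V, g \oc m = f.
Proof.
move=> resP /(_ P resP) extC K B m e ee me f.
have [projP [augE ex0 ex1]] := resP; have /kernelP[em0 mm mfac] := me.
have [g gE] := projP 0 _ _ _ ee (laug P).
have [L [l kl]] := ab_kernel abA (laug P).
have /kernelP[al0 lm lfac] := kl.
have [p pe pE] := exact_kernel_factor ex0 kl.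
have [|t tE] := mfac _ (g \oc l); first by rewrite compA gE al0.
have [|s sE] := (extC (f \oc t \oc p)).1.
  have -> : hom_pre (ld P 1) (f \oc t \oc p) = f \oc t \oc (p \oc ld P 1).
    by rewrite /hom_pre !compA.
  have -> : p \oc ld P 1 = 0 by apply: lm; rewrite compA pE ld_ld compm0.
  exact: compm0.
have slE : s \oc l = f \oc t by apply: pe; rewrite -sE -compA pE.
have [S [i1 [i2 [p1 [p2 [p1i1 p2i2 p1i2 p2i1 _]]]]]] :=
  ab_biproduct abA K (lobj P 0).
pose c := m \oc p1 + g \oc p2; pose phi := f \oc p1 + s \oc p2.
have ci1 : c \oc i1 = m.
  by rewrite compDl -!compA p1i1 p2i1 compm1 compm0 addr0.
have ci2 : c \oc i2 = g.
  by rewrite compDl -!compA p1i2 p2i2 compm1 compm0 add0r.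
have ce : epi c.
  have /cokernelP[_ _ efac] := epi_cokernel ee me.
  apply/epi0P => T u uc0.
  have [|w wE] := efac _ u; first by rewrite -ci1 compA uc0 comp0m.
  suff w0 : w = 0 by rewrite -wE w0 comp0m.
  apply: augE; rewrite comp0m -gE compA.
  by rewrite [w \oc e]wE -ci2 compA uc0 comp0m.
have [J [j kj]] := ab_kernel abA c.
have /cokernelP[_ _ cfac] := epi_cokernel ce kj; have /kernelP[cj0 _ _] := kj.
have [|x xE] := cfac _ phi; last first.
  exists x; rewrite -ci1 compA xE compDl -!compA p1i1 p2i1.
  by rewrite compm1 compm0 addr0.
(* It remains to see that [phi] kills the kernel [j] of [c]: there [p2 \oc j] is [l \oc v] and
   [p1 \oc j] is [- (t \oc v)], and the two contributions cancel because [s \oc l = f \oc t]. *)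
have cj : m \oc (p1 \oc j) = - (g \oc (p2 \oc j)).
  by apply/eqP; rewrite -addr_eq0 !compA -compDl cj0.
have [|v vE] := lfac _ (p2 \oc j).
  rewrite -gE -compA; apply: oppr_inj.
  by rewrite -compNr -cj compA em0 comp0m oppr0.
have p1jE : p1 \oc j = - (t \oc v).
  by apply: mm; rewrite cj -vE compNr !compA tE.
by rewrite compDl -!compA p1jE -vE compNr !compA slE addNr.
Qed.

(** The shift is done on cochains. A 1-cocycle [t] in [C] lifts to [t'] in [I], whose coboundary is
    a 2-cocycle [r] in [K] and so bounds some [r']. The corrected [t' - m \oc r'] descends to the
    image of [ld P 0] and extends to [P_0] as [I] is injective. *)
Lemma Ext2_dimension_shift_injective U K I C (m : hom K I) (e : hom I C) :
  injective_obj I -> is_kernel e m -> epi e ->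
  Ext_zero 2 U K -> Ext_zero 1 U C.
Proof.
move=> injI me ee extU P resP; have [projP [augE ex0 ex1]] := resP => t.
rewrite /hom_pre; split=> [td0 | [w <-]]; last by rewrite -compA ld_ld compm0.
have /kernelP[em0 mm mfac] := me.
have [t' tE] := projP 1 _ _ _ ee t.
have [|r rE] := mfac _ (t' \oc ld P 1); first by rewrite compA tE.
have [|r' r'E] := (extU P resP r).1.
  by apply: mm; rewrite /hom_pre compm0 compA rE -compA ld_ld compm0.
have [L [l [p [lm pe pE]]]] := mono_epi_factor (ld P 0).
have := ex1 0; rewrite -pE => /exact_cokernel/(_ lm pe)/cokernelP[_ _ pfac].
have [|w wE] := pfac _ (t' - m \oc r').
  by rewrite compBl -compA [r' \oc _]r'E rE subrr.
have [w' w'E] := injI _ _ _ lm w.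
exists (e \oc w'); rewrite -!compA (compA w') w'E wE compBr compA em0 comp0m.
by rewrite subr0.
Qed.

(** Splicing a resolution of [K] with [P0] gives one of [C] with all degrees raised by one. Since
    [Ext_zero] speaks of every resolution, the hypothesis on [C] applies to this one. *)
Lemma Ext2_dimension_shift_projective C V K P0 (k : hom K P0) (e : hom P0 C) :
  projective P0 -> is_kernel e k -> epi e ->
  Ext_zero 2 C V -> Ext_zero 1 K V.
Proof.
move=> projP0 ke ee extC P [projP [augE ex0 ex1]].
have /kernelP[ek0 km _] := ke.
have d0 : e \oc (k \oc laug P) = 0 by rewrite compA ek0 comp0m.
pose d n := match n with
  | 0 => k \oc laug P
  | n.+1 => ld P n
  end : hom (lobj P n) (if n is n'.+1 then lobj P n' else P0).
have dd n : d n \oc d n.+1 = 0.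
  by case: n => [|n] /=; [rewrite -compA laug_ld compm0 | exact: ld_ld].
apply: (extC (@LeftComplex A C (fun n => if n is n'.+1 then lobj P n' else P0)
  e d d0 dd)).
split; first by case=> [|n]; [exact: projP0 | exact: projP].
split=> [||[|n]]; [exact: ee | exact: exact_splice | | exact: ex1].
exact: exact_mono_comp km ex0.
Qed.


(** * Vanishing of Ext from a zero object *)

Lemma exact_projective_lift P M N T (f : hom M N) (g : hom N T) :
  projective P -> exact f g ->
  forall t : hom P N, g \oc t = 0 -> exists w : hom P M, f \oc w = t.
Proof.
move=> projP fg t gt0; have [K [k kg]] := ab_kernel abA g.
have [p pe <-] := exact_kernel_factor fg kg.
have /kernelP[_ _ kfac] := kg; have [v <-] := kfac _ _ gt0.
by have [w <-] := projP _ _ _ pe v; exists w; rewrite compA.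
Qed.

(* A projective resolution of 0 splits: [d_n s_n d_n = d_n] yields [s_n.+1] with
   [d_n.+1 s_n.+1 = 1 - s_n d_n]. *)
Lemma zero_Ext_zero (Z V : A) i : zero_object Z -> (1 <= i)%N -> Ext_zero i Z V.
Proof.
move=> Z0; case: i => // i _ P [projP [_ ex0 ex1]].
have split_next n (s : hom (lobj P n) (lobj P n.+1)) :
    ld P n \oc (s \oc ld P n) = ld P n ->
    exists s', ld P n.+1 \oc s' = idm _ - s \oc ld P n.
  move=> sE; apply: (exact_projective_lift (projP _) (ex1 n)).
  by rewrite compBr sE compm1 subrr.
have [s sE] : exists s, ld P i \oc (s \oc ld P i) = ld P i.
  elim: i => [|n [s /split_next[s' s'E]]].
    (* The augmentation maps to a zero object, so it kills the identity of [P_0], which therefore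
       lifts along [ld P 0]. *)
    have [|s sE] := exact_projective_lift (t := idm _) (projP _) ex0.
      exact: Z0.2.
    by exists s; rewrite compA sE comp1m.
  by exists s'; rewrite compA s'E compBl comp1m -compA ld_ld compm0 subr0.
have [s' s'E] := split_next _ _ sE => h; rewrite /hom_pre.
split=> [hd0 | [x <-]]; last by rewrite -compA ld_ld compm0.
exists (h \oc s); apply/eqP; rewrite eq_sym -subr_eq0.
by rewrite -{1}[h]compm1 -compA -compBr -s'E compA hd0 comp0m.
Qed.

(** * Existence of projective resolutions *)

Record projective_cover M := ProjectiveCover {
  pc_syz : A;
  pc_obj : A;
  pc_inc : hom pc_syz pc_obj;
  pc_map : hom pc_obj M;
  pc_projective : projective pc_obj;
  pc_epi : epi pc_map;
  pc_kernel : is_kernel pc_map pc_inc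
}.

(** [Ext_zero] quantifies over all resolutions, so using it requires one. A cover is chosen for
    every object, which makes the syzygies an iteration. *)
Lemma projective_resolution_exists (projA : enough_projectives A) M :
  exists P : left_complex M, projective_resolution P.
Proof.
have cover N : exists c : projective_cover N, True.
  have [P [e [projP ee]]] := projA N; have [K [k ke]] := ab_kernel abA e.
  by exists (ProjectiveCover projP ee ke).
pose c N := proj1_sig (constructive_indefinite_description _ (cover N)).
pose syz n := iter n (fun N => pc_syz (c N)) M.
pose d n : hom (pc_obj (c (syz n.+1))) (pc_obj (c (syz n))) :=
  pc_inc (c (syz n)) \oc pc_map (c (syz n.+1)).
have inc0 N : pc_map (c N) \oc pc_inc (c N) = 0.
  by have /kernelP[] := pc_kernel (c N).
have d0 : pc_map (c M) \oc d 0 = 0 by rewrite compA inc0 comp0m.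
have dd n : d n \oc d n.+1 = 0.
  by rewrite -compA (compA (pc_map _)) inc0 comp0m compm0.
exists (@LeftComplex A M (fun n => pc_obj (c (syz n))) _ d d0 dd).
have ex N : exact (pc_inc (c N) \oc pc_map (c (pc_syz (c N)))) (pc_map (c N)).
  by apply: exact_splice; [exact: pc_epi | exact: pc_epi | exact: pc_kernel].
split=> [n|]; first exact: pc_projective.
split=> [||n]; [exact: pc_epi | exact: ex |].
by apply: exact_mono_comp (ex _); have /kernelP[] := pc_kernel (c (syz n)).
Qed.

(** * Lifting and extension from the equality of the two orthogonal classes *)

Section BalancedClasses.
Variables (X Y : A -> Prop).
Hypothesis projA : enough_projectives A.
Hypothesis injA : enough_injectives A.
Hypothesis perpXY : forall M : A, rperp_at X 1 M <-> lperp_at Y 1 M.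

Lemma rperp_lifts U K : X U -> rperp X K -> lifts_with_kernel U K.
Proof.
move=> XU perpK; have [P resP] := projective_resolution_exists projA U.
exact: Ext1_lifts resP (perpK 1%N isT U XU).
Qed.

Lemma lperp_extends C V : Y V -> lperp Y C ->
  forall K B (m : hom K B) (e : hom B C), epi e -> is_kernel e m ->
  forall f : hom K V, exists g : hom B V, g \oc m = f.
Proof.
move=> YV perpC; have [P resP] := projective_resolution_exists projA C.
exact: Ext1_extends resP (perpC 1%N isT V YV).
Qed.

Lemma rperp_extends V K : Y V -> rperp X K -> extends_along_monos V K.
Proof.
move=> YV perpK B m mm f.
have [I [i [injI im]]] := injA K; have [C [q cq]] := ab_cokernel abA i.
have /cokernelP[_ qe _] := cq; have kq := mono_kernel im cq.
have perpC : lperp_at Y 1 C.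
  apply/perpXY => U XU.
  exact: Ext2_dimension_shift_injective injI kq qe (perpK 2 isT U XU).
have [P resP] := projective_resolution_exists projA C.
have [g <-] := Ext1_extends resP (perpC V YV) qe kq f.
by have [h <-] := injI _ _ _ mm i; exists (g \oc h); rewrite compA.
Qed.

(** The dual of [rperp_extends], proved directly because [Ext_zero] is computed by projective
    resolutions and is not formally self-dual. The syzygy [K] of [C] lies in both orthogonal
    classes, so [h] lifts to the projective [P0], and from there along [e]. *)
Lemma lperp_lifts U C : X U -> lperp Y C ->
  forall B (e : hom B C), epi e ->
  forall h : hom U C, exists g : hom U B, e \oc g = h.
Proof.
move=> XU perpC B e ee h.
have [P0 [p [projP0 pe]]] := projA C; have [K [k kp]] := ab_kernel abA p.
have perpK : rperp_at X 1 K.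
  apply/perpXY => V YV.
  exact: Ext2_dimension_shift_projective projP0 kp pe (perpC 2 isT V YV).
have [P resP] := projective_resolution_exists projA U.
have [g <-] := Ext1_lifts resP (perpK U XU) pe kp h.
by have [x <-] := projP0 _ _ _ ee p; exists (x \oc g); rewrite compA.
Qed.

End BalancedClasses.
End Abelian.

(** * Right complexes as left complexes of the opposite category *)

Section OppositeCategory.
Variables (A : preaddCat) (abA : abelian A).
Let abop := abelian_op abA.

(** The fields are unchanged, so [right_pre_exact] and [right_post_exact] of [R] are convertible to
    [left_post_exact] and [left_pre_exact] of this complex. *)
Definition op_right (N : A) (R : right_complex N) :
    @left_complex (opcat A) N :=
  @LeftComplex (opcat A) N (@robj A N R) (raug R) (rd R) (rd_raug R) (rd_rd R).

Lemma exact_right_op (N : A) (R : right_complex N) :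
  exact_right R -> exact_left (op_right R).
Proof.
move=> [mono_aug ex0 exS]; split=> [||n]; first exact: mono_aug.
  exact: (iffLR (exact_op abA _ _) ex0).
exact: (iffLR (exact_op abA _ _) (exS n)).
Qed.

Lemma right_pre_exactI (V N : A) (R : right_complex N) :
  exact_right R -> @coker_in A (@lifts_with_kernel (opcat A) V) _ _ (raug R) ->
  (forall n, @coker_in A (@lifts_with_kernel (opcat A) V) _ _ (rd R n)) ->
  right_pre_exact V R.
Proof.
by move=> /exact_right_op; apply: (@left_post_exactI (opcat A) abop V N).
Qed.

Lemma right_post_exactI (U N : A) (R : right_complex N) :
  exact_right R ->
  @coker_in A (@extends_along_monos (opcat A) U) _ _ (raug R) ->
  (forall n, @coker_in A (@extends_along_monos (opcat A) U) _ _ (rd R n)) ->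
  right_post_exact U R.
Proof.
by move=> /exact_right_op; apply: (@left_pre_exactI (opcat A) abop U N).
Qed.

Definition trivial_right_complex (Z N : A) : right_complex N.
Proof.
refine (@RightComplex A N (fun n => if n is _.+1 then Z else N) (idm N)
  (fun _ => 0) _ _) => *; exact: comp0m.
Defined.

Lemma exact_trivial_right_complex (Z N : A) :
  zero_object Z -> exact_right (trivial_right_complex Z N).
Proof.
move=> [Z0 Z1]; have Zop : @zero_object (opcat A) Z by split.
have [epi_aug ex0 exS] := @exact_trivial_left_complex (opcat A) Z Zop N.
split=> [||n]; first exact: epi_aug.
  exact: (iffRL (exact_op abA _ _) ex0).
exact: (iffRL (exact_op abA _ _) (exS n)).
Qed.

Lemma trivial_right_complex_coker_in (W : A -> Prop) (Z N : A) :
  zero_object Z -> W Z ->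
  coker_in W (raug (trivial_right_complex Z N)) /\
  forall n, coker_in W (rd (trivial_right_complex Z N) n).
Proof.
move=> [Z0 Z1]; have Zop : @zero_object (opcat A) Z by split.
exact: (@trivial_left_complex_ker_in (opcat A) Z Zop W N).
Qed.

End OppositeCategory.

Lemma ker_in_sub (A : preaddCat) (W W' : A -> Prop) (M N : A) (f : hom M N) :
  (forall K, W K -> W' K) -> ker_in W f -> ker_in W' f.
Proof. by move=> sW [K [k [kf WK]]]; exists K, k; split; last exact: sW. Qed.

Lemma coker_in_sub (A : preaddCat) (W W' : A -> Prop) (M N : A) (f : hom M N) :
  (forall Q, W Q -> W' Q) -> coker_in W f -> coker_in W' f.
Proof. by move=> sW [Q [q [qf WQ]]]; exists Q, q; split; last exact: sW. Qed.

(** * Exact resolutions with orthogonal kernels or cokernels *)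

Section Resolutions.
Variables (A : preaddCat) (abA : abelian A).
Variables (projA : enough_projectives A) (injA : enough_injectives A).
Variables (X Y : A -> Prop).

Section Left.
Variables (M : A) (R : left_complex M).
Hypotheses (XR : left_resolution X R) (exR : exact_left R).
Hypothesis (kaug : ker_in (rperp X) (laug R)).
Hypothesis (kd : forall n, ker_in (rperp X) (ld R n)).

Lemma exact_left_proper : proper_left X R.
Proof.
split=> // U XU; have lift K := @rperp_lifts A abA X projA U K XU.
by apply: left_post_exactI => // [|n]; apply: ker_in_sub lift _.
Qed.

Lemma exact_left_pre_acyclic :
  (forall M : A, rperp_at X 1 M <-> lperp_at Y 1 M) -> left_pre_acyclic Y R.
Proof.
move=> perpXY V YV.
have ext K := @rperp_extends A abA X Y projA injA perpXY V K YV.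
by apply: left_pre_exactI => // [|n]; apply: ker_in_sub ext _.
Qed.

End Left.

Section Right.
Variables (N : A) (R : right_complex N).
Hypotheses (YR : right_resolution Y R) (exR : exact_right R).
Hypothesis (caug : coker_in (lperp Y) (raug R)).
Hypothesis (cd : forall n, coker_in (lperp Y) (rd R n)).

Lemma exact_right_proper : proper_right Y R.
Proof.
split=> // V YV.
(* In [A] this asks that maps into [V] extend along every monomorphism with cokernel [Q]. *)
have ext Q : lperp Y Q -> @lifts_with_kernel (opcat A) V Q.
  move=> perpQ B C q m mm qm.
  have /cokernelP[_ qe _] : @is_cokernel A C B m Q q := qm.
  exact: (lperp_extends abA projA YV perpQ qe (mono_kernel abA mm qm)).
by apply: right_pre_exactI => // [|n]; apply: coker_in_sub ext _.
Qed.

Lemma exact_right_post_acyclic :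
  (forall M : A, rperp_at X 1 M <-> lperp_at Y 1 M) -> right_post_acyclic X R.
Proof.
move=> perpXY U XU.
have lift Q : lperp Y Q -> @extends_along_monos (opcat A) U Q.
  by move=> perpQ; exact: (lperp_lifts abA projA perpXY XU perpQ).
by apply: right_post_exactI => // [|n]; apply: coker_in_sub lift _.
Qed.

End Right.

Lemma sub_plres0 (zeroX : contains_zero X) (M : A) : X M -> plres0 X M.
Proof.
move=> XM; have [Z Z0] := ab_zero abA.
pose R := trivial_left_complex Z M.
have XR : left_resolution X R by case=> [//|n]; exact: zeroX.
have perpZ : rperp X Z by move=> i i1 U _; exact: Ext_zero_zero.
have [kaug kd] := trivial_left_complex_ker_in Z0 M perpZ.
have exR := exact_trivial_left_complex Z0 M.
by split; exists R; first exact: exact_left_proper.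
Qed.

Lemma sub_prres0 (zeroY : contains_zero Y) (N : A) : Y N -> prres0 Y N.
Proof.
move=> YN; have [Z Z0] := ab_zero abA.
pose R := trivial_right_complex Z N.
have YR : right_resolution Y R by case=> [//|n]; exact: zeroY.
(* Maps into [Z] vanish, but maps out of a projective resolution of [Z] need not, so here its
   splitting is used. *)
have perpZ : lperp Y Z by move=> i i1 V _; exact: (zero_Ext_zero abA).
have [caug cd] := trivial_right_complex_coker_in N Z0 perpZ.
have exR := exact_trivial_right_complex abA N Z0.
by split; exists R; first exact: exact_right_proper.
Qed.

End Resolutions.

Theorem theorem4p11 (A : preaddCat) (abA : abelian A)
    (projA : enough_projectives A) (injA : enough_injectives A)
    (X Y : A -> Prop)
    (isoX : iso_closed X) (isoY : iso_closed Y)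
    (zeroX : contains_zero X) (zeroY : contains_zero Y)
    (perpXY : forall M : A, rperp_at X 1 M <-> lperp_at Y 1 M) :
  admissible_balanced_pair X Y (plres0 X) (prres0 Y).
Proof.
split.
- exact: sub_plres0.
- by move=> M [].
- exact: sub_prres0.
- by move=> N [].
(* The exact resolution supplied by [plres0] serves itself: its exactness gives admissibility, its
   kernels give properness and acyclicity. *)
- move=> M [_ [R [XR exR kaug kd]]]; exists R; have [? ? _] := exR.
  split; last exact: (exact_left_pre_acyclic abA projA injA exR kaug kd perpXY).
  by split=> //; exact: (exact_left_proper abA projA XR exR kaug kd).
- move=> N [_ [R [YR exR caug cd]]]; exists R; have [? ? _] := exR.
  split; last exact: (exact_right_post_acyclic abA projA exR caug cd perpXY).
  by split=> //; exact: (exact_right_proper abA projA YR exR caug cd).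
Qed.
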